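(* Let $G$ be an Abelian group, $X$ a topological space with $|X|\ge 2$, and $f\colon G\to X$ a Korovin mapping. If the Korovin orbit $G_f\subset X^G$ is infinite and pseudocompact, then $G_f$ is not homeomorphic to any pseudocompact Mal'tsev space.
   Context: Let $(G,+)$ be an Abelian group and $X$ a topological space with at least two elements. The group $G$ (carrying no topology) acts on the set $X^G$ of all maps $G\to X$ by $s\colon G\times X^G\to X^G$, $s(g,f)(h)=f(g+h)$ for $f\in X^G$, $g,h\in G$. An element $f\in X^G$ is called a Korovin mapping if for every $M\subset G$ with $|M|\leq\omega$ and every $h\in X^M$ there exists $g\in G$ such that $h=s(g,f)|_M$. For a Korovin mapping $f$, the Korovin orbit is the subspace $G_f=\{s(g,f): g\in G\}$ of $X^G$, where $X^G$ has the product topology. A Mal'tsev operation on a set $Z$ is a map $M\colon Z^3\to Z$ such that $M(y,y,x)=M(x,y,y)=x$ for all $x,y\in Z$. A Mal'tsev space is a topological space $Z$ with a Mal'tsev operation that is (jointly) continuous on $Z^3$. A space is pseudocompact if it is Tychonoff (completely regular and Hausdorff) and every continuous real-valued function on it is bounded. *)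

(* Defs.v *)
From HB Require Import structures.
From mathcomp Require Export all_boot all_order all_algebra.
From mathcomp Require Export all_classical all_reals all_analysis.
Export numFieldNormedType.Exports.

Set Implicit Arguments.
Unset Strict Implicit.
Unset Printing Implicit Defensive.

Local Open Scope classical_set_scope.
Local Open Scope ring_scope.

Section Korovin.
Context {G : zmodType} {X : topologicalType}.

Definition translate (g : G) (f : G -> X) : G -> X := fun h => f (g + h).

(* The partial map h is defined on M seen as a type; sigL M is restriction
   to M. *)
Definition korovin_mapping (f : G -> X) : Prop :=
  forall M : set G, countable M ->
  forall h : M -> X, exists g : G, h = sigL M (translate g f).

(* {ptws G -> X} carries the product topology, which the orbit, once coerced
   to a type, inherits as a subspace. *)
Definition korovin_orbit (f : G -> X) : set {ptws G -> X} :=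
  [set translate g f | g in [set: G]].

End Korovin.

Definition maltsev_operation (Z : Type) (M : Z * Z * Z -> Z) : Prop :=
  forall x y : Z, M (y, y, x) = x /\ M (x, y, y) = x.

Definition maltsev_space (Z : topologicalType) : Prop :=
  exists2 M : Z * Z * Z -> Z, maltsev_operation M & continuous M.

(* The library phrases completely_regular_space without reference to the
   reals; uniform_separatorP gives the usual separation of a point from a
   closed set by a continuous function with values in [0, 1]. *)
Definition tychonoff_space (T : topologicalType) : Prop :=
  completely_regular_space T /\ hausdorff_space T.

Definition pseudocompact (R : realType) (T : topologicalType) : Prop :=
  tychonoff_space T /\ forall u : T -> R, continuous u -> bounded_fun u.

Definition homeomorphic (S T : topologicalType) : Prop :=
  exists (u : S -> T) (v : T -> S),
    [/\ cancel u v, cancel v u, continuous u & continuous v].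

(* Main.v *)
Require Import Defs.
Import Order.TTheory GRing.Theory Num.Theory.
From mathcomp Require Import lra.
Set Implicit Arguments.
Unset Strict Implicit.
Unset Printing Implicit Defensive.
Local Open Scope classical_set_scope.
Local Open Scope ring_scope.

(** Why a pseudocompact Korovin orbit S carries no continuous Mal'tsev
operation M.

Two facts contradict each other. On one side, pseudocompactness bounds how much
a continuous function of two variables can vary: if F : S * Y -> R is continuous
and every sequence of nonempty open sets of S * Y has a cluster point, then
b |-> F (b, -) is continuous for the sup distance, so every sequence b_i of
points of S contains two terms whose slices are uniformly as close as desired
([slices_totally_bounded]). This applies with Y = S * S: a point of S may be
prescribed on three disjoint translates of a countable set of coordinates, so
that, as far as countably many open sets can see, S * (S * S) is a continuous
image of S ([feebly_compact_orbit3]).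

On the other side, the Korovin property lets a single coordinate h take
prescribed values on any countable subset of S ([orbit_colouring]). Fix pairwise
distinct points b_i. For i < j the map c |-> M (b_i, b_j, c) sends b_j to b_i,
so it moves all points of a neighbourhood of b_j, which is infinite; this leaves
room to pick for every pair a point c_ij, moved to some d_ij, so that the graph
with edges c_ij -- d_ij is a forest, hence 2-colourable. Choose h so that the
coordinate h of a point is x0 or x1 according to its colour. If phi : X -> R is
continuous with phi x0 != phi x1, then F (b, (a, c)) := phi (M (a, b, c) h) is
continuous, and the values
  F (b_i, (b_i, c_ij)) = phi (c_ij h)  and  F (b_j, (b_i, c_ij)) = phi (d_ij h)
differ by |phi x0 - phi x1| for all i < j, contradicting total boundedness.

As X is arbitrary, phi has to come from the orbit. The orbit is completely
regular, so there is a nonconstant continuous w : S -> R; by pseudocompactness w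
depends on countably many coordinates only ([depends_on_countable]), and since S
realises all patterns on countably many coordinates, w already varies along a
single one of them, which gives phi ([nonconstant_on_factor]). *)

(** * Feebly compact spaces *)

(** Pseudocompactness in terms of open sets: no sequence of nonempty open sets
is locally finite. Unlike boundedness of real functions, this form is easy to
transport along continuous maps that are far from surjective. *)
Definition feebly_compact (T : topologicalType) : Prop :=
  forall (p : nat -> T) (U : nat -> set T), (forall n, nbhs (p n) (U n)) ->
  exists x : T, forall N, nbhs x N ->
    forall n, exists2 m, (n <= m)%N & U m `&` N !=set0.

(** On a locally finite sequence of neighbourhoods U n of p n, the function
sum_n n * phi_n, with phi_n a bump at p n supported in U n, would be continuous
and unbounded. *)
Lemma pseudocompact_feebly_compact (R : realType) (T : topologicalType) :
  pseudocompact R T -> feebly_compact T.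
Proof.
move=> [[crT _] bT] p U pU; apply: contrapT => nocl.
have /choice[N HN] : forall x : T, exists N : set T * nat,
    nbhs x N.1 /\ forall m, (N.2 <= m)%N -> U m `&` N.1 = set0.
  move=> x; apply: contrapT => Hx; apply: nocl; exists x => N xN n.
  apply: contrapT => Hn; apply: Hx; exists (N, n); split=> // m nm.
  by rewrite -subset0 => y UNy; apply: Hn; exists m => //; exists y.
have /choice[phi Hphi] : forall n, exists phi : T -> R,
    [/\ continuous phi, forall x, 0 <= phi x, phi (p n) = 1 &
        forall x, ~ U n x -> phi x = 0].
  move=> n.
  have /(@uniform_separatorP _ R)[g [cg rg g0 g1]] :
      uniform_separator [set p n] (~` (U n)°).
    apply: crT; first exact/open_closedC/open_interior.
    by apply; exact: pU.
  exists (fun x => 1 - g x); split.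
  - by move=> x; apply: cvgB; [exact: cvg_cst|exact: cg].
  - move=> x; have : `[0, 1]%classic (g x) by apply: rg; exists x.
    by rewrite /= in_itv/= subr_ge0 => /andP[].
  - by rewrite (g0 (g (p n))) ?subr0//; exists (p n).
  - move=> x Ux; rewrite (g1 (g x)) ?subrr//; exists x => //= Ux'.
    by apply: Ux; exact: interior_subset Ux'.
pose S K x := \sum_(k < K) k%:R * phi k x.
have cS K : continuous (S K).
  elim: K => [|K IH] x.
    have -> : S 0%N = cst 0 by apply/funext => y; rewrite /S big_ord0.
    exact: cvg_cst.
  have -> : S K.+1 = S K \+ (fun y => K%:R * phi K y).
    by apply/funext => y; rewrite /S big_ord_recr.
  apply: cvgD; first exact: IH.
  by apply: cvgMl_tmp; have [c _ _ _] := Hphi K; exact: c.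
(* Near x only the first (N x).2 bumps contribute, so there the limit of the
   partial sums is one of the partial sums. *)
have S_stable x y K : (N x).1 y -> ((N x).2 <= K)%N -> S K y = S (N x).2 y.
  move=> Ny xK; rewrite /S -!(big_mkord predT (fun k => k%:R * phi k y)).
  rewrite (big_cat_nat (leq0n _) xK)//= [X in _ + X]big_nat
    [X in _ + X]big1 ?addr0// => k /andP[xk _].
  have [_ _ _ ->] := Hphi k; first by rewrite mulr0.
  move=> Uk; have [_ /(_ k xk) UN0] := HN x.
  by have : (U k `&` (N x).1) y by []; rewrite UN0.
pose u x := S (N x).2 x.
have u_near x y K : (N x).1 y -> ((N x).2 <= K)%N -> u y = S K y.
  move=> Ny xK; rewrite (S_stable x)// /u.
  rewrite -(S_stable x _ (maxn (N x).2 (N y).2))//; last exact: leq_maxl.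
  apply/esym/S_stable; last exact: leq_maxr.
  by have [/nbhs_singleton] := HN y.
have cu : continuous u.
  move=> x; apply: (@cvg_trans _ (S (N x).2 @ x)); last exact: cS.
  apply: near_eq_cvg; have [Nx _] := HN x.
  by apply: filterS Nx => y Ny; rewrite (u_near x y (N x).2).
have [M [_ /(_ (M + 1))]] := bT u cu.
rewrite ltrDl ltr01 => /(_ isT) uM.
have [n nM] : exists n : nat, M + 1 < n%:R.
  exists (Num.bound `|M + 1|).
  exact: le_lt_trans (ler_norm _) (archi_boundP (normr_ge0 _)).
have := uM (p n) I; apply/negP; rewrite -ltNge (lt_le_trans nM)//.
apply: le_trans (ler_norm _).
rewrite (u_near (p n) _ (maxn (N (p n)).2 n.+1)) ?leq_maxl//; last first.
  by have [/nbhs_singleton] := HN (p n).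
have nK : (n < maxn (N (p n)).2 n.+1)%N by rewrite leq_maxr.
rewrite /S (bigD1 (Ordinal nK))//=.
have [_ _ -> _] := Hphi n; rewrite mulr1 lerDl sumr_ge0// => k _.
by rewrite mulr_ge0//; have [_ + _ _] := Hphi k.
Qed.

Section glicksberg.
Context {R : realType} {S Y : topologicalType} (F : S * Y -> R).
Hypothesis cF : continuous F.
Hypothesis fcSY : feebly_compact (S * Y)%type.

(** If this failed at b0, there would be points (b_n, y_n) with b_n in smaller
and smaller neighbourhoods U_n of b0 and F (b_n, y_n) far from F (b0, y_n). By
continuity the gap persists between B_n * V_n and U_(n+1) * V_n. Since B_m is
included in U_(n+1) for m > n, F oscillates too much near a cluster point of the
sets B_n * V_n. *)
Lemma slices_equicontinuous b0 (e : R) : 0 < e ->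
  nbhs b0 [set b | forall y, `|F (b, y) - F (b0, y)| <= e].
Proof.
move=> e0; apply: contrapT => nb.
have e4 : 0 < e / 4 by rewrite divr_gt0.
have osc z : exists N : set S * set Y, [/\ nbhs z.1 N.1, nbhs z.2 N.2 &
    forall b y, N.1 b -> N.2 y -> `|F (b, y) - F z| < e / 4].
  have /cvgr_distC_lt/(_ _ e4)[[N1 N2] [zN1 zN2] HN] : F @ z --> F z.
    exact: cF.
  by exists (N1, N2); split => // b y Nb Ny; apply: HN.
have /choice[step Hstep] : forall U : {U | nbhs b0 U}, exists
    s : S * Y * set S * set Y * {U | nbhs b0 U},
    let: (b, y, B, V, U') := s in
    [/\ nbhs b B, nbhs y V, B `<=` sval U, sval U' `<=` sval U &
      forall b y b', B b -> V y -> sval U' b' ->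
        e / 2 < `|F (b, y) - F (b', y)|].
  move=> [U bU] /=.
  have [b [Ub [y by_gt]]] : exists b, U° b /\
      exists y, e < `|F (b, y) - F (b0, y)|.
    apply: contrapT => Hb; apply: nb.
    move/nbhs_interior: bU; apply: filterS => b Ub y.
    rewrite leNgt; apply/negP => Hy; apply: Hb.
    by exists b; split=> //; exists y.
  have [[B V] /= [bB yV HBV]] := osc (b, y).
  have [[U' V'] /= [bU' yV' HUV']] := osc (b0, y).
  exists (b, y, B `&` U, V `&` V', exist _ _ (filterI bU' bU)) => /=; split.
  - exact: filterI.
  - exact: filterI.
  - exact: subIsetr.
  - exact: subIsetr.
  - move=> b1 y1 b' [/HBV Bb _] [Vy V'y] [/HUV' U'b _].
    move: (Bb _ Vy) (U'b _ V'y) by_gt.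
    rewrite !ltr_norml => /andP[? ?] /andP[? ?].
    by rewrite !ltr_normr => /orP[?|?]; apply/orP; [left|right]; lra.
have b0T : nbhs b0 setT by exact: filterT.
pose U := fix U n : {U | nbhs b0 U} :=
  if n is n'.+1 then (step (U n')).2 else exist _ setT b0T.
pose b n := (step (U n)).1.1.1.1; pose y n := (step (U n)).1.1.1.2.
pose B n := (step (U n)).1.1.2; pose V n := (step (U n)).1.2.
have HU n : [/\ nbhs (b n) (B n), nbhs (y n) (V n), B n `<=` sval (U n),
    sval (U n.+1) `<=` sval (U n) & forall b y b', B n b -> V n y ->
    sval (U n.+1) b' -> e / 2 < `|F (b, y) - F (b', y)|].
  by have := Hstep (U n); rewrite /b /y /B /V /=; case: (step (U n)) => -[[[]]].
have Umono m n : (m <= n)%N -> sval (U n) `<=` sval (U m).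
  move=> /subnK <-; elim: (n - m)%N => [//|k IH]; rewrite addSn.
  by have [_ _ _ UU _] := HU (k + m)%N; exact: subset_trans UU IH.
have [x Hx] : exists x : S * Y, forall N, nbhs x N ->
    forall n, exists2 m, (n <= m)%N & (B m `*` V m) `&` N !=set0.
  apply: (@fcSY (fun n => (b n, y n))) => n.
  by have [? ? _ _ _] := HU n; exists (B n, V n).
have [[N1 N2] /= [xN1 xN2 HN]] := osc x.
have xN : nbhs x (N1 `*` N2) by exists (N1, N2).
have [n _ [[b1 y1] [[/= Bb1 Vy1] [/= Nb1 Ny1]]]] := Hx _ xN 0%N.
(* A later index m > n, so that b2 lies in U_(n+1) and is compared with b1 at
   the same second coordinate y1. *)
have [m nm [[b2 y2] [[/= Bb2 Vy2] [/= Nb2 Ny2]]]] := Hx _ xN n.+1.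
have Ub2 : sval (U n.+1) b2.
  by apply: (Umono _ _ nm); have [_ _ /(_ _ Bb2) + _ _] := HU m.
have [_ _ _ _ /(_ _ _ _ Bb1 Vy1 Ub2)] := HU n.
have := HN _ _ Nb1 Ny1; have := HN _ _ Nb2 Ny1.
rewrite !ltr_norml ltr_normr => /andP[? ?] /andP[? ?] /orP[?|?]; lra.
Qed.

(** The e/4-balls of the sup distance around the points b i are neighbourhoods,
and two of them come within e/4 of a cluster point. *)
Lemma slices_totally_bounded (b : nat -> S) (e : R) : 0 < e ->
  exists i j, (i < j)%N /\ forall y, `|F (b i, y) - F (b j, y)| <= e.
Proof.
move=> e0; have [[y0 _]|Y0] := pselect ([set: Y] !=set0); last first.
  by exists 0%N, 1%N; split => // y; exfalso; apply: Y0; exists y.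
have e4 : 0 < e / 4 by rewrite divr_gt0.
pose N b0 := [set b | forall y, `|F (b, y) - F (b0, y)| <= e / 4].
have [[x y] Hx] : exists x : S * Y, forall N', nbhs x N' -> forall n, exists2 m,
    (n <= m)%N & (N (b m) `*` setT) `&` N' !=set0.
  apply: (@fcSY (fun n => (b n, y0))) => n.
  exists (N (b n), setT) => //=; split; last exact: filterT.
  exact: slices_equicontinuous.
have xN : nbhs (x, y) (N x `*` setT).
  exists (N x, setT) => //=; split; last exact: filterT.
  exact: slices_equicontinuous.
have [i _ [[c ?] [[/= ic _] [/= xc _]]]] := Hx _ xN 0%N.
have [j ij [[d ?] [[/= jd _] [/= xd _]]]] := Hx _ xN i.+1.
exists i, j; split => // z.
move: (ic z) (xc z) (jd z) (xd z); rewrite !ler_norml.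
by move=> /andP[? ?] /andP[? ?] /andP[? ?] /andP[? ?]; apply/andP; split; lra.
Qed.

End glicksberg.

(** * Subspaces of products that fill all countable faces *)

Definition fills_countable_faces {I : choiceType} {X : topologicalType}
    (A : set {ptws I -> X}) : Prop :=
  forall M : set I, countable M -> forall k : I -> X,
  exists p : A, forall i, M i -> sval p i = k i.

Section boxes.
Context {I : choiceType} {X : topologicalType} {A : set {ptws I -> X}}.

Lemma coordinate_continuous i : continuous (fun p : A => sval p i).
Proof.
move=> p; apply: (@continuous_comp A {ptws I -> X} X sval (proj i)).
  exact: initial_continuous.
exact: proj_continuous.
Qed.

(** Boxes form a filter that converges to p coordinatewise, hence in the product
topology, so that every neighbourhood of p contains a box. *)
Lemma nbhs_boxP (p : A) (N : set A) : nbhs p N ->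
  exists (E : seq I) (V : I -> set X), (forall i, nbhs (sval p i) (V i)) /\
    forall z : A, (forall i, i \in E -> V i (sval z i)) -> N z.
Proof.
pose box : set_system {ptws I -> X} :=
  fun D => exists (E : seq I) (V : I -> set X),
  (forall i, nbhs (sval p i) (V i)) /\
  forall z : {ptws I -> X}, (forall i, i \in E -> V i (z i)) -> D z.
have box_filter : Filter box.
  split.
  - by exists [::], (fun=> setT); split=> // i; exact: filterT.
  - move=> D1 D2 [E1 [V1 [pO1 OD1]]] [E2 [V2 [pO2 OD2]]].
    exists (E1 ++ E2), (fun i => V1 i `&` V2 i).
    split=> [i|z Hz]; first exact: filterI.
    split; [apply: OD1|apply: OD2] => i iE.
      by have := Hz i; rewrite mem_cat iE => /(_ isT)[].
    by have := Hz i; rewrite mem_cat iE orbT => /(_ isT)[].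
  - move=> D1 D2 D12 [E [V [pO OD]]]; exists E, V; split=> // z Hz.
    exact/D12/OD.
have box_cvg : box --> (sval p : {ptws I -> X}).
  apply/cvg_sup => i D /=; rewrite (@nbhsE (initial_topology _)).
  move=> [_ [[C oC <-] Cp] CD].
  exists [:: i], (fun j => if j == i then C else setT); split.
    move=> j; case: eqVneq => [->|_]; last exact: filterT.
    exact: open_nbhs_nbhs.
  by move=> z /(_ i); rewrite mem_head eqxx => /(_ isT) Cz; exact: CD.
move=> [_ [[C oC <-] Cp] CN].
have /box_cvg[E [V [pO OC]]] : nbhs (sval p) C by exact: open_nbhs_nbhs.
by exists E, V; split=> // z Hz; apply: CN; exact: OC.
Qed.

Lemma box_nbhs (p : A) (E : seq I) (V : I -> set X) :
  (forall i, i \in E -> nbhs (sval p i) (V i)) ->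
  nbhs p [set z : A | forall i, i \in E -> V i (sval z i)].
Proof.
elim: E => [|i E IH] pO.
  by apply: filterS (@filterT _ (nbhs p) _).
have /IH{IH}pE j : j \in E -> nbhs (sval p j) (V j).
  by move=> jE; apply: pO; rewrite inE jE orbT.
have pi : nbhs p [set z : A | V i (sval z i)].
  by apply: coordinate_continuous; apply: pO; rewrite mem_head.
apply: filterS (filterI pi pE) => z [/= Oz Ez] j.
by rewrite inE => /orP[/eqP->//|/Ez].
Qed.

End boxes.

Lemma countable_seq {I : choiceType} (E : seq I) : countable [set` E].
Proof. exact: finite_set_countable (finite_seq E). Qed.

Lemma countableU {T : Type} (A B : set T) :
  countable A -> countable B -> countable (A `|` B).
Proof.
move=> cA cB; rewrite -bigcup2E; apply: bigcup_countable => //.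
by move=> [|[|n]] _ //=.
Qed.

Section factorization.
Context {R : realType} {I : choiceType} {X : topologicalType}.
Context {A : set {ptws I -> X}}.
Hypothesis fullA : fills_countable_faces A.
Hypothesis fcA : feebly_compact A.
Context (w : A -> R).
Hypothesis cw : continuous w.

Let fill (E : seq I) (k : I -> X) :
  exists p : A, forall i, i \in E -> sval p i = k i.
Proof. by have [p Hp] := fullA (countable_seq E) k; exists p. Qed.

(** Otherwise there are, for each of a growing sequence of finite sets F_n,
points x_n and y_n that agree on F_n and on which w differs by more than e.
Boxes around x_n and y_n witness the difference using coordinates of F_(n+1)
only, and they can be taken equal on F_n. A box with finite support E around a
cluster point z of the first boxes does not meet F_(n+1) \ F_n for n large; as
soon as it meets the box of x_n it therefore also meets the box of y_n, and w
oscillates too much on it. *)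
Lemma approx_depends_on_finite (e : R) : 0 < e -> exists E : seq I,
  forall x y : A, (forall i, i \in E -> sval x i = sval y i) ->
    `|w x - w y| <= e.
Proof.
move=> e0; apply: contrapT => nE.
have e4 : 0 < e / 4 by rewrite divr_gt0.
have osc (z : A) : exists (E : seq I) (V : I -> set X),
    (forall i, nbhs (sval z i) (V i)) /\
    forall y : A, (forall i, i \in E -> V i (sval y i)) -> `|w y - w z| < e / 4.
  have : nbhs z [set y | `|w y - w z| < e / 4].
    have /cvgr_distC_lt/(_ _ e4) : w @ z --> w z by exact: cw.
    by [].
  by move/nbhs_boxP => [E [V HV]]; exists E, V.
have /choice[step Hstep] : forall F : seq I, exists
    s : A * A * (I -> set X) * (I -> set X) * seq I,
    let: (x, y, V, P, F') := s in
    [/\ forall i, nbhs (sval x i) (V i), forall i, nbhs (sval y i) (P i),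
      {subset F <= F'}, forall i, i \in F -> V i = P i &
      forall x' y' : A, (forall i, i \in F' -> V i (sval x' i)) ->
        (forall i, i \in F' -> P i (sval y' i)) -> e / 2 < `|w x' - w y'|].
  move=> F.
  have [x [y [xyF by_gt]]] : exists x y : A,
      (forall i, i \in F -> sval x i = sval y i) /\ e < `|w x - w y|.
    apply: contrapT => Hxy; apply: nE; exists F => x y xyF.
    by rewrite leNgt; apply/negP => ?; apply: Hxy; exists x, y.
  have [E1 [V1 [xO1 HO1]]] := osc x; have [E2 [V2 [yO2 HO2]]] := osc y.
  exists (x, y, (fun i => if i \in F then V1 i `&` V2 i else V1 i),
    (fun i => if i \in F then V1 i `&` V2 i else V2 i), F ++ (E1 ++ E2)).
  split.
  - by move=> i; case: ifP => // iF; apply: filterI => //; rewrite xyF.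
  - by move=> i; case: ifP => // iF; apply: filterI => //; rewrite -xyF.
  - by move=> i iF; rewrite mem_cat iF.
  - by move=> i ->.
  - move=> x' y' x'V y'P.
    have x'V1 i : i \in E1 -> V1 i (sval x' i).
      move=> iE; have := x'V i; rewrite !mem_cat iE !orbT.
      by case: ifP => _ /(_ isT) => [[]|].
    have y'V2 i : i \in E2 -> V2 i (sval y' i).
      move=> iE; have := y'P i; rewrite !mem_cat iE !orbT.
      by case: ifP => _ /(_ isT) => [[]|].
    move: (HO1 _ x'V1) (HO2 _ y'V2) by_gt.
    rewrite !ltr_norml => /andP[? ?] /andP[? ?].
    by rewrite !ltr_normr => /orP[?|?]; apply/orP; [left|right]; lra.
pose F := fix F n := if n is n'.+1 then (step (F n')).2 else [::].
pose x n := (step (F n)).1.1.1.1; pose y n := (step (F n)).1.1.1.2.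
pose V n := (step (F n)).1.1.2; pose P n := (step (F n)).1.2.
have HF n : [/\ forall i, nbhs (sval (x n) i) (V n i),
    forall i, nbhs (sval (y n) i) (P n i), {subset F n <= F n.+1},
    forall i, i \in F n -> V n i = P n i &
    forall x' y' : A, (forall i, i \in F n.+1 -> V n i (sval x' i)) ->
      (forall i, i \in F n.+1 -> P n i (sval y' i)) -> e / 2 < `|w x' - w y'|].
  by have := Hstep (F n); rewrite /x /y /V /P /=; case: (step (F n)) => -[[[]]].
have Fmono m n : (m <= n)%N -> {subset F m <= F n}.
  move=> /subnK <-; elim: (n - m)%N => [//|k IH] i /IH; rewrite addSn.
  by have [_ _ + _ _] := HF (k + m)%N; apply.
have [z Hz] : exists z : A, forall N, nbhs z N ->
    forall n, exists2 m, (n <= m)%N &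
    [set x' : A | forall i, i \in F m.+1 -> V m i (sval x' i)] `&` N !=set0.
  by apply: (@fcA x) => n; apply: box_nbhs => i _; have [+ _ _ _ _] := HF n.
have [E [Q [zQ HQ]]] := osc z.
(* The trace of the finite set E on F_n is constant from n0 on. *)
have [n0 Hn0] : exists n0, forall i, i \in E ->
    forall n, i \in F n -> i \in F n0.
  elim: E {HQ} => [|i E [n0 IH]]; first by exists 0%N.
  have [[m im]|ni] := pselect (exists m, i \in F m); last first.
    exists n0 => j; rewrite inE => /orP[/eqP->|/IH//] n iF.
    by exfalso; apply: ni; exists n.
  exists (maxn n0 m) => j; rewrite inE => /orP[/eqP->|/IH jE] n jF.
    by apply: (Fmono m) => //; exact: leq_maxr.
  by apply: (Fmono n0); [exact: leq_maxl|exact: jE jF].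
have zE : nbhs z [set x' : A | forall i, i \in E -> Q i (sval x' i)].
  by apply: box_nbhs => i _; exact: zQ.
have [n n0n [x' [/= Ox' Qx']]] := Hz _ zE n0.
have [_ yP Fn OP gap] := HF n.
(* The point x' moved into the box of y_n, by changing only coordinates outside
   E. *)
have [y' Hy'] := fill (E ++ F n.+1) (fun i =>
  if i \in F n then sval x' i else if i \in F n.+1 then sval (y n) i
  else sval x' i).
have Qy' i : i \in E -> Q i (sval y' i).
  move=> iE; rewrite Hy' ?mem_cat ?iE//.
  case: ifP => iFn; first exact: Qx'.
  case: ifP => [iFn1|_]; last exact: Qx'.
  by move: iFn; rewrite (Fmono _ _ n0n _ (Hn0 i iE _ iFn1)).
have Py' i : i \in F n.+1 -> P n i (sval y' i).
  move=> iF; rewrite Hy' ?mem_cat ?iF ?orbT//.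
  case: ifP => iFn; first by rewrite -OP//; exact: Ox'.
  exact: nbhs_singleton.
move: (gap _ _ Ox' Py') (HQ _ Qx') (HQ _ Qy').
by rewrite !ltr_norml ltr_normr => /orP[?|?] /andP[? ?] /andP[? ?]; lra.
Qed.

Lemma depends_on_countable : exists2 C : set I, countable C &
  forall x y : A, (forall i, C i -> sval x i = sval y i) -> w x = w y.
Proof.
have /choice[E HE] : forall n : nat, exists E : seq I,
    forall x y : A, (forall i, i \in E -> sval x i = sval y i) ->
    `|w x - w y| <= n.+1%:R^-1.
  by move=> n; apply: approx_depends_on_finite; rewrite invr_gt0.
exists (\bigcup_n [set` E n]).
  by apply: bigcup_countable => // n _; exact: countable_seq.
move=> x y xy; apply/eqP; rewrite -subr_eq0 -normr_le0.
apply/ler_addgt0Pr => e e0; rewrite add0r.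
have [n ne] : exists n : nat, n.+1%:R^-1 < e.
  exists (Num.bound e^-1); rewrite -[ltRHS]invrK ltf_pV2 ?posrE ?invr_gt0//.
  apply: lt_trans (archi_boundP _) _; first by rewrite invr_ge0 ltW.
  by rewrite ltr_nat.
apply: le_trans (ltW ne); apply: HE => i iE; apply: xy; by exists n.
Qed.

(** Changing finitely many coordinates one at a time and then passing to the
limit leads from x0 to y0 as far as w can see, so some change of a single
coordinate i changes w. Freezing the other relevant coordinates at those of a
point z turns w into a function phi of the coordinate i; phi is continuous
because the projections of boxes of A are boxes. *)
Lemma nonconstant_on_factor (x0 y0 : A) : w x0 != w y0 ->
  exists2 phi : X -> R, continuous phi & exists a b, phi a != phi b.
Proof.
move=> wxy; have [C cC HC] := depends_on_countable.
have full (E : seq I) k : exists p : A,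
    forall i, C i \/ i \in E -> sval p i = k i.
  have [p Hp] := fullA (countableU cC (countable_seq E)) k.
  by exists p.
have [i [z [z' [zz' wzz']]]] : exists i (z z' : A),
    (forall j, C j -> j != i -> sval z j = sval z' j) /\ w z != w z'.
  apply: contrapT => Hi.
  have w1 i (z z' : A) : (forall j, C j -> j != i -> sval z j = sval z' j) ->
      w z = w z'.
    move=> zz'; apply/eqP/negP => /negP ?; by apply: Hi; exists i, z, z'.
  have wfin (E : seq I) : forall z z' : A,
      (forall j, C j -> j \notin E -> sval z j = sval z' j) -> w z = w z'.
    elim: E => [|i E IH] z z' zz'; first by apply: HC => j Cj; exact: zz'.
    have [z2 Hz2] :=
      full [::] (fun j => if j == i then sval z' j else sval z j).
    transitivity (w z2).
      by apply: (w1 i) => j Cj /negPf ji; rewrite Hz2 ?ji//; left.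
    apply: IH => j Cj jE; rewrite Hz2; last by left.
    case: eqVneq => // ji; apply: zz' => //.
    by rewrite inE negb_or ji.
  have e0 : 0 < `|w x0 - w y0| / 2 by rewrite divr_gt0// normr_gt0 subr_eq0.
  have [E HE] := approx_depends_on_finite e0.
  have [z Hz] := full E (fun j => if j \in E then sval y0 j else sval x0 j).
  have wzx : w z = w x0.
    by apply: (wfin E) => j Cj /negPf jE; rewrite Hz ?jE//; left.
  have : `|w z - w y0| <= `|w x0 - w y0| / 2.
    by apply: HE => j jE; rewrite Hz ?jE//; right.
  rewrite wzx => ?; move: e0; lra.
have /choice[psi Hpsi] : forall x, exists p : A,
    forall j, C j \/ j \in [:: i] ->
    sval p j = if j == i then x else sval z j.
  by move=> x; exact: full.
have psii x : sval (psi x) i = x.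
  by rewrite Hpsi ?eqxx//; right; rewrite mem_head.
exists (w \o psi); last first.
  exists (sval z i), (sval z' i).
  suff: w (psi (sval z i)) = w z /\ w (psi (sval z' i)) = w z'.
    by move=> [/= -> ->].
  split; apply: HC => j Cj; rewrite Hpsi; try (by left);
    by case: eqVneq => [->//|ji]; rewrite ?zz'.
move=> x W /= wW.
have /nbhs_boxP[E [V [xO HO]]] : nbhs (psi x) (w @^-1` W) by exact: cw.
have Oi : nbhs x (V i) by rewrite -{1}(psii x).
apply: filterS Oi => x' Ox'.
(* psi x' need not be close to psi x; the point q is, and has the same image
   under w as psi x'. *)
have [q Hq] := full (i :: E) (fun j => if j == i then x' else sval (psi x) j).
rewrite /= (_ : w (psi x') = w q).
  apply: HO => j jE; rewrite Hq; last by right; rewrite inE jE orbT.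
  by case: eqVneq => [->//|_]; exact: nbhs_singleton.
apply: HC => j Cj; rewrite Hq; last by left.
by rewrite !Hpsi; try (by left); case: ifP.
Qed.

End factorization.

(** * Continuity of maps between products *)

Lemma continuous_pair (T U V : topologicalType) (f : T -> U) (g : T -> V) :
  continuous f -> continuous g -> continuous (fun x => (f x, g x)).
Proof. by move=> cf cg x; apply: cvg_pair; [exact: cf|exact: cg]. Qed.

Lemma fst_continuous (U V : topologicalType) : continuous (@fst U V).
Proof. by move=> x; exact: cvg_fst. Qed.

Lemma snd_continuous (U V : topologicalType) : continuous (@snd U V).
Proof. by move=> x; exact: cvg_snd. Qed.

Lemma comp_continuous (T U V : topologicalType) (f : T -> U) (g : U -> V) :
  continuous f -> continuous g -> continuous (g \o f).
Proof. by move=> cf cg x; apply: continuous_comp; [exact: cf|exact: cg]. Qed.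

(** * Choosing and colouring sequences of points *)

(** With g n := id the terms of c are pairwise distinct; in general the pairs
(c n, g n (c n)) are the edges of a forest, as each c n is a new vertex. *)
Lemma greedy_sequence (T : choiceType) (P : nat -> T -> Prop)
    (g : nat -> T -> T) :
  (forall n (L : seq T), exists2 c, c \notin L & P n c) ->
  exists c : nat -> T, forall n, P n (c n) /\
    forall m, (m < n)%N -> c n != c m /\ c n != g m (c m).
Proof.
move=> /(_ _ _)/cid2 pick.
pose pk n L := s2val (pick L n).
pose L := fix L n : seq T := if n is n'.+1 then
  let c := pk n' (L n') in [:: c, g n' c & L n'] else [::].
pose c n := pk n (L n).
exists c => n; split; first exact: (s2valP' (pick (L n) n)).
move=> m mn; have cL : c n \notin L n := s2valP (pick (L n) n).
have Lmn : {subset [:: c m; g m (c m)] <= L n}.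
  elim: n mn {cL} => // n IH; rewrite ltnS leq_eqVlt => /predU1P[->|mn] x.
    by rewrite /= !inE => /orP[|] /eqP->; rewrite eqxx ?orbT.
  by move=> /(IH mn) xL; rewrite /= !inE xL !orbT.
by split; apply: contraNneq cL => ->; apply: Lmn; rewrite !inE eqxx ?orbT.
Qed.

(** Each new edge c n -- d n has the fresh end c n, so colours can be assigned
one edge at a time: c n receives the colour opposite to the current colour of d
n, and no colour already used by an edge is ever revised. *)
Lemma forest_two_colouring (T : choiceType) (c d : nat -> T) :
  (forall n, c n != d n) ->
  (forall m n, (m < n)%N -> c n != c m /\ c n != d m) ->
  exists col : T -> bool, forall n, col (c n) = ~~ col (d n).
Proof.
move=> cd cn.
(* K n is the colouring after the first n edges; col is its eventual value. *)
pose K := fix K n : T -> bool := if n is m.+1 then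
  fun x => if x == c m then ~~ K m (d m) else K m x else fun=> false.
have stable x n : (forall m, (n <= m)%N -> x != c m) ->
    forall m, (n <= m)%N -> K m x = K n x.
  move=> xc m /subnK <-; elim: (m - n)%N => [//|k IH].
  by rewrite addSn /= (negPf (xc _ _)) ?leq_addl.
pose col x := `[< exists n, forall m, (n <= m)%N -> K m x >].
have colE x n : (forall m, (n <= m)%N -> x != c m) -> col x = K n x.
  move=> /stable Kx; apply/asboolP/idP => [[m Hm]|Kn].
    by rewrite -(Kx (maxn n m)) ?leq_maxl//; apply: Hm; rewrite leq_maxr.
  by exists n => m /Kx ->.
exists col => n; rewrite (colE _ n.+1) => [|m nm]; last first.
  by rewrite eq_sym; have [] := cn _ _ nm.
rewrite (colE (d n) n.+1) => [|m nm]; last first.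
  by rewrite eq_sym; have [] := cn _ _ nm.
by rewrite /= eqxx eq_sym (negPf (cd n)).
Qed.

Lemma nbhs_avoids_finite (T : topologicalType) : hausdorff_space T ->
  (forall (p : T) N, nbhs p N -> exists2 q, N q & q != p) ->
  forall (L : seq T) (p : T) N, nbhs p N -> exists2 q, q \notin L & N q.
Proof.
move=> hT perfect; elim=> [|l L IH] p N pN.
  by exists p => //; exact: nbhs_singleton.
have [c Nc cl] : exists2 c, N° c & c != l.
  have [<-|pl] := eqVneq p l; last by exists p.
  by apply: perfect; exact: nbhs_interior.
have cN : nbhs c (N `&` ~` [set l]).
  apply: filterI => //; apply: open_nbhs_nbhs; split; last exact/eqP.
  apply: closed_openC; apply: accessible_closed_set1.
  exact: hausdorff_accessible.
have [q qL [Nq /eqP ql]] := IH _ _ cN.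
by exists q => //; rewrite inE negb_or ql.
Qed.

(** * Korovin orbits *)

Section orbit.
Context {G : zmodType} {X : topologicalType} (f : G -> X).
Hypothesis f_korovin : korovin_mapping f.
Local Notation S := (korovin_orbit f).

Lemma translate_in_orbit g : translate g f \in S.
Proof. by apply/mem_set; exists g. Qed.

Definition orbit_point g : S :=
  exist (fun p => p \in S) _ (translate_in_orbit g).

Lemma orbit_fills_countable_faces : fills_countable_faces S.
Proof.
move=> M cM k; have [g Hg] := f_korovin cM (sigL M k).
exists (orbit_point g) => i Mi; rewrite /=.
by have /(congr1 (fun u => u (exist _ i (mem_set Mi)))) := Hg.
Qed.

Lemma orbit_shift g (p : S) : translate g (sval p) \in S.
Proof.
case: p => _ /= /set_mem[g' _ <-]; apply/mem_set.
by exists (g' + g) => //; apply/funext => h; rewrite /translate addrA.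
Qed.

Definition shift g (p : S) : S := exist (fun p => p \in S) _ (orbit_shift g p).

Lemma shift_continuous g : continuous (shift g).
Proof.
move=> p N /nbhs_boxP[E [V [pV VN]]].
have : nbhs p [set z : S |
    forall h, h \in map (+%R g) E -> V (h - g) (sval z h)].
  apply: (box_nbhs (V := fun h => V (h - g))) => _ /mapP[h _ ->].
  by have := pV h; rewrite addrAC subrr add0r.
apply: filterS => z Hz; apply: VN => h hE /=.
by have := Hz _ (map_f _ hE); rewrite addrAC subrr add0r.
Qed.

Hypothesis X_ge2 : exists x y : X, x <> y.

Lemma exists_other (x : X) : exists y, y <> x.
Proof.
have [a [b ab]] := X_ge2; have [ax|] := pselect (a = x); last by exists a.
by exists b => bx; apply: ab; rewrite ax bx.
Qed.

(** A Cantor diagonal argument: if g belongs to A, a translate by g whose value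
at each a in A is not f (a + a) contradicts itself at a = g. *)
Lemma exists_notin_countable (A : set G) : countable A -> exists g, ~ A g.
Proof.
move=> cA; have /choice[k Hk] : forall a, exists y, y <> f (a + a).
  by move=> a; exact: exists_other.
have [g Hg] := f_korovin cA (sigL A k).
exists g => Ag; apply: (Hk g).
by have /(congr1 (fun u => u (exist _ g (mem_set Ag)))) := Hg.
Qed.

Lemma orbit_perfect (p : S) N : nbhs p N -> exists2 q, N q & q != p.
Proof.
move=> /nbhs_boxP[E [V [pV VN]]].
have [g gE] := exists_notin_countable (countable_seq E).
have [y yp] := exists_other (sval p g).
have [q Hq] := orbit_fills_countable_faces (countable_seq (g :: E))
  (fun h => if h == g then y else sval p h).
exists q; last first.
  apply/eqP => qp; apply: yp.
  by rewrite -qp Hq ?eqxx//= mem_head.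
apply: VN => h hE; rewrite Hq /= ?inE ?hE ?orbT//.
case: eqVneq => [hg|_]; last exact: (nbhs_singleton (pV h)).
by exfalso; apply: gE; rewrite /= -hg.
Qed.

(** Countably many neighbourhoods U n of points P n involve a countable set A of
coordinates only. As G is uncountable, A, g2 + A and g3 + A are pairwise
disjoint for suitable g2 and g3, and some a n in S copies the three components
of P n on these sets. So psi z := (z, z shifted by g2, z shifted by g3) is a
continuous map from S that sends a n into the interior of U n, and cluster
points of the preimages of the U n are sent to cluster points of the U n. *)
Lemma feebly_compact_orbit3 : feebly_compact S ->
  feebly_compact (S * (S * S))%type.
Proof.
move=> fcS P U PU.
have /choice[E HE] : forall n, exists E : seq G, forall x y z : S,
    (forall h, h \in E -> [/\ sval x h = sval (P n).1 h,
      sval y h = sval (P n).2.1 h & sval z h = sval (P n).2.2 h]) ->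
    (U n)° (x, (y, z)).
  move=> n; have /nbhs_interior[[N1 N2] /= [N1P [[N3 N4]]]] := PU n.
  move=> /= [N3P N4P] N34 N12.
  have [E1 [V1 [pV1 VN1]]] := nbhs_boxP N1P.
  have [E2 [V2 [pV2 VN2]]] := nbhs_boxP N3P.
  have [E3 [V3 [pV3 VN3]]] := nbhs_boxP N4P.
  exists (E1 ++ (E2 ++ E3)) => x y z H; apply: N12; split=> /=.
    apply: VN1 => h hE; have [|-> _ _] := H h; last exact: nbhs_singleton.
    by rewrite !mem_cat hE.
  apply: N34; split=> /=.
    apply: VN2 => h hE; have [|_ -> _] := H h; last exact: nbhs_singleton.
    by rewrite !mem_cat hE orbT.
  apply: VN3 => h hE; have [|_ _ ->] := H h; last exact: nbhs_singleton.
  by rewrite !mem_cat hE !orbT.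
pose A := \bigcup_n [set` E n].
have cA : countable A.
  by apply: bigcup_countable => // n _; exact: countable_seq.
pose B := (fun x : G * G => x.1 - x.2) @` (A `*` A).
have cB : countable B.
  by apply: sub_countable (countableX cA cA); exact: card_image_le.
have [g2 g2B] := exists_notin_countable cB.
have [g3 g3B] : exists g, ~ (B `|` (fun b => g2 + b) @` B) g.
  apply: exists_notin_countable; apply: countableU => //.
  by apply: sub_countable cB; exact: card_image_le.
have g2A a : A a -> ~ A (g2 + a).
  by move=> Aa Ag; apply: g2B; exists (g2 + a, a) => //=; rewrite addrK.
have g3A a : A a -> ~ A (g3 + a).
  by move=> Aa Ag; apply: g3B; left; exists (g3 + a, a) => //=; rewrite addrK.
have g32A a : A a -> ~ A (g3 + a - g2).
  move=> Aa Ag; apply: g3B; right; exists (g3 - g2).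
    by exists (g3 + a - g2, a) => //=; rewrite addrAC addrK.
  by rewrite addrC subrK.
have /choice[a Ha] : forall n, exists a : S, forall h, A h ->
    [/\ sval a h = sval (P n).1 h, sval a (g2 + h) = sval (P n).2.1 h &
        sval a (g3 + h) = sval (P n).2.2 h].
  move=> n.
  have cA3 : countable (A `|` ((+%R g2) @` A `|` (+%R g3) @` A)).
    do 2?[apply: countableU => //]; apply: sub_countable cA.
      exact: card_image_le.
    exact: card_image_le.
  have [a Ha] := orbit_fills_countable_faces cA3 (fun h =>
    if `[< A h >] then sval (P n).1 h else
    if `[< A (h - g2) >] then sval (P n).2.1 (h - g2)
    else sval (P n).2.2 (h - g3)).
  exists a => h Ah; split.
  - by rewrite Ha; [rewrite asboolT|left].
  - rewrite Ha; last by right; left; exists h.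
    by rewrite asboolF; [rewrite addrAC subrr add0r asboolT|exact: g2A].
  - rewrite Ha; last by right; right; exists h.
    rewrite asboolF; last exact: g3A.
    by rewrite asboolF; [rewrite addrAC subrr add0r|exact: g32A].
pose psi (z : S) := (z, (shift g2 z, shift g3 z)).
have cpsi : continuous psi.
  apply: continuous_pair; first by move=> z; exact: cvg_id.
  by apply: continuous_pair; exact: shift_continuous.
have [z Hz] : exists z : S, forall N, nbhs z N -> forall n,
    exists2 m, (n <= m)%N & (psi @^-1` U m) `&` N !=set0.
  apply: (fcS a) => n; apply: cpsi; apply: HE => h hE.
  by apply: Ha; exists n.
exists (psi z) => N zN n.
have [m nm [y [Uy Ny]]] := Hz _ (cpsi _ _ zN) n.
by exists m => //; exists (psi y).
Qed.

(** The coordinate h of the translate by g is the coordinate g of the translate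
by h, because G is commutative. Prescribing the values of the points c n at a
common coordinate h thus amounts to prescribing one translate, that by h, on a
countable set of coordinates. *)
Lemma orbit_colouring (c : nat -> S) (col : S -> bool) (x0 x1 : X) :
  exists h : G, forall n, sval (c n) h = if col (c n) then x1 else x0.
Proof.
have /choice[gamma Hgamma] : forall p : S, exists g, translate g f = sval p.
  by move=> [_ /= /set_mem[g _ <-]]; exists g.
have cD : countable (range (gamma \o c)).
  by apply: sub_countable (countableP setT); exact: card_image_le.
have [p Hp] := orbit_fills_countable_faces cD
  (fun a => if col (orbit_point a) then x1 else x0).
exists (gamma p) => n; rewrite -(Hgamma (c n)) /translate addrC.
transitivity (sval p (gamma (c n))); first by rewrite -(Hgamma p).
rewrite Hp; last by exists n.
by congr (if col _ then _ else _); apply/val_inj => /=; rewrite Hgamma.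
Qed.

End orbit.

(** * Mal'tsev operations on Korovin orbits *)

Section maltsev.
Context {R : realType} {G : zmodType} {X : topologicalType} (f : G -> X).
Hypothesis f_korovin : korovin_mapping f.
Hypothesis X_ge2 : exists x y : X, x <> y.
Local Notation S := (korovin_orbit f).
Hypothesis pcS : pseudocompact R S.

(** X inherits a nonconstant real function from its Korovin orbit, which has one
because it is completely regular and has two points. *)
Lemma nonconstant_on_values : exists2 phi : X -> R, continuous phi &
  exists a b, phi a != phi b.
Proof.
have full := orbit_fills_countable_faces f_korovin.
have [p0 _] := full set0 (countable0 _) f.
have [p1 _ p10] := orbit_perfect f_korovin X_ge2 (@filterT _ (nbhs p0) _).
have [[crS hS] _] := pcS.
have /(@uniform_separatorP _ R)[w [cw _ w0 w1]] :
    uniform_separator [set p0] [set p1].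
  apply: crS; last by apply/eqP; rewrite eq_sym.
  exact/accessible_closed_set1/hausdorff_accessible.
apply: (nonconstant_on_factor full (pseudocompact_feebly_compact pcS) cw
  (x0 := p0) (y0 := p1)).
rewrite (w0 (w p0)); last by exists p0.
rewrite (w1 (w p1)); last by exists p1.
by rewrite eq_sym oner_eq0.
Qed.

Lemma orbit_not_maltsev : ~ maltsev_space S.
Proof.
move=> [M MM cM].
have [[_ hS] _] := pcS.
have fcS := pseudocompact_feebly_compact pcS.
have avoid := nbhs_avoids_finite hS (@orbit_perfect _ _ _ f_korovin X_ge2).
have [p0 _] := orbit_fills_countable_faces f_korovin (countable0 _) f.
have [b Hb] : exists b : nat -> S, forall n, True /\
    forall m, (m < n)%N -> b n != b m /\ b n != b m.
  apply: (@greedy_sequence S (fun _ _ => True) (fun=> id)) => n L.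
  by have [q] := avoid L p0 setT filterT; exists q.
(* pr enumerates the pairs i < j; the default (0, 1) makes every pr n such a
   pair, so that t n is never the identity M (y, y, -). *)
pose pr n := let q := odflt (0, 1)%N (unpickle n : option (nat * nat)) in
  if (q.1 < q.2)%N then q else (0, 1)%N.
have pr_lt n : ((pr n).1 < (pr n).2)%N by rewrite /pr; case: ifP.
pose t n c := M (b (pr n).1, b (pr n).2, c).
have [c Hc] : exists c : nat -> S, forall n, t n (c n) != c n /\
    forall m, (m < n)%N -> c n != c m /\ c n != t m (c m).
  apply: (@greedy_sequence S (fun n c => t n c != c) t) => n L.
  have ct : continuous (t n).
    apply: comp_continuous cM; apply: continuous_pair.
      exact: cst_continuous.
    by move=> x; exact: cvg_id.
  (* t n moves b_j to b_i, hence moves all points of a neighbourhood of b_j. *)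
  have tb : t n (b (pr n).2) = b (pr n).1.
    by rewrite /t; have [_ ->] := MM (b (pr n).1) (b (pr n).2).
  have b12 : b (pr n).2 != b (pr n).1.
    by have [_ /(_ _ (pr_lt n))[]] := Hb (pr n).2.
  move: hS; rewrite open_hausdorff => /(_ _ _ b12).
  move=> [[V W] /= [/set_mem Vb /set_mem Wb] [oV oW VW0]].
  apply: (avoid L (b (pr n).2)).
  have nV : nbhs (b (pr n).2) V by exact: open_nbhs_nbhs.
  have nW : nbhs (b (pr n).2) (t n @^-1` W).
    by apply: ct; rewrite tb; exact: open_nbhs_nbhs.
  apply: filterS (filterI nV nW) => q [Vq Wq]; apply/eqP => tq.
  have : (V `&` W) q by split=> //; rewrite -tq.
  by move/eqP: VW0 => ->.
have [col Hcol] : exists col : S -> bool,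
    forall n, col (c n) = ~~ col (t n (c n)).
  apply: forest_two_colouring => [n|m n mn]; last by have [_ /(_ _ mn)] := Hc n.
  by rewrite eq_sym; have [] := Hc n.
have [phi cphi [x0 [x1 x01]]] := nonconstant_on_values.
(* The ends of all edges are merged into one sequence: the c n are at odd and
   their images at even positions. *)
have [h Hh] := orbit_colouring f_korovin
  (fun n => if odd n then c n./2 else t n./2 (c n./2)) col x0 x1.
pose F (z : S * (S * S)) : R := phi (sval (M (z.2.1, z.1, z.2.2)) h).
have cF : continuous F.
  apply: (comp_continuous (f := fun z => sval (M (z.2.1, z.1, z.2.2)) h)) cphi.
  apply: (comp_continuous (f := fun z => M (z.2.1, z.1, z.2.2))
    (g := fun p : S => sval p h)); last exact: coordinate_continuous.
  apply: comp_continuous cM; apply: continuous_pair.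
    apply: continuous_pair; last exact: fst_continuous.
    exact: comp_continuous (@snd_continuous _ _) (@fst_continuous _ _).
  exact: comp_continuous (@snd_continuous _ _) (@snd_continuous _ _).
have e0 : 0 < `|phi x0 - phi x1| / 2 by rewrite divr_gt0// normr_gt0 subr_eq0.
have fc3 := feebly_compact_orbit3 f_korovin X_ge2 fcS.
have [i [j [ij close]]] := slices_totally_bounded cF fc3 b e0.
pose n := pickle (i, j).
have prn : pr n = (i, j) by rewrite /pr pickleK /= ij.
(* First argument b_i: the slice at b_i then fixes c n, and that at b_j moves
   it. *)
have := close (b i, c n); rewrite /F /=.
have [-> _] := MM (c n) (b i).
have -> : M (b i, b j, c n) = t n (c n) by rewrite /t prn.
have := Hh n.*2.+1; rewrite /= odd_double /= uphalf_double => ->.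
have := Hh n.*2; rewrite odd_double doubleK => ->.
rewrite Hcol; case: (col _) => /=; last rewrite [leLHS]distrC.
all: by move: e0; lra.
Qed.

End maltsev.

Lemma homeomorphic_maltsev (S T : topologicalType) :
  homeomorphic S T -> maltsev_space T -> maltsev_space S.
Proof.
move=> [u [v [uK vK cu cv]]] [M MM cM].
exists (fun z => v (M (u z.1.1, u z.1.2, u z.2))).
  by move=> x y /=; have [-> ->] := MM (u x) (u y); rewrite uK.
apply: comp_continuous cv; apply: comp_continuous cM.
apply: continuous_pair; last exact: comp_continuous (@snd_continuous _ _) cu.
apply: continuous_pair; apply: comp_continuous cu.
  exact: comp_continuous (@fst_continuous _ _) (@fst_continuous _ _).
exact: comp_continuous (@fst_continuous _ _) (@snd_continuous _ _).
Qed.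

Theorem corollary2 (R : realType) (G : zmodType) (X : topologicalType)
    (X_ge2 : exists x y : X, x <> y)
    (f : G -> X) (f_korovin : korovin_mapping f)
    (Gf_infinite : infinite_set (korovin_orbit f))
    (Gf_pseudocompact : pseudocompact R (korovin_orbit f)) :
  forall Z : topologicalType, pseudocompact R Z -> maltsev_space Z ->
    ~ homeomorphic (korovin_orbit f) Z.
Proof.
move=> Z _ mZ hZ.
exact: (orbit_not_maltsev f_korovin X_ge2 Gf_pseudocompact)
  (homeomorphic_maltsev hZ mZ).
Qed.
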